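(* Let $\mathcal F$ be a class of general frames over a finite alphabet $\mathrm{Al}$ that is closed under countable disjoint sums. Then the modal depth of $\mathcal F$ equals the modal depth of its logic $\mathrm{Log}\,\mathcal F$.
   Context: A general frame is $F=(X,(R_\Diamond)_{\Diamond\in\mathrm{Al}},\mathcal A)$ with $\mathcal A$ a Boolean subalgebra of $\mathcal P(X)$ closed under $V\mapsto R_\Diamond^{-1}[V]$; a valuation takes variables to $\mathcal A$; a formula is valid in $F$ if true at all points under all such valuations; $\mathrm{Log}\,\mathcal F$ is the set of formulas valid in all members of $\mathcal F$. The disjoint sum of general frames $F_i$ ($i\in I$) has domain the disjoint union, relations the unions, and admissible sets those $V$ with $V\cap X_i\in\mathcal A_i$ for all $i$. Modal depth of frames: for $\mathcal V\subseteq\mathcal P(X)$, $a\equiv_{\mathcal V}b$ iff $\forall V\in\mathcal V\,(a\in V\Leftrightarrow b\in V)$; $\sim_{\mathcal V,0}=\equiv_{\mathcal V}$, $\mathcal V_0=X/{\sim_{\mathcal V,0}}$; for $d\ge1$, $\sim_{\mathcal V,d}$ is the equivalence induced by $\mathcal V_{d-1}\cup\{R_\Diamond^{-1}[V]:\Diamond\in\mathrm{Al},V\in\mathcal V_{d-1}\}$ and $\mathcal V_d=X/{\sim_{\mathcal V,d}}$; $\mathcal V_\omega=\bigcup_d\mathcal V_d$; $\mathrm{md}(V)=\min\{d:V\in\mathcal V_d\}$ for $V\in\mathcal V_\omega$; $\mathrm{md}(\mathcal V)=\sup_{V\in\mathcal V_\omega}\mathrm{md}(V)$; $\mathrm{md}(F)=\sup\{\mathrm{md}(\mathcal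 V):\mathcal V$ a finite subset of $\mathcal A\}$; $\mathrm{md}(\mathcal F)=\sup_{F\in\mathcal F}\mathrm{md}(F)$. Modal depth of logics: $\mathrm{md}(\varphi)$ is the maximal nesting of modalities, $\mathrm{md}_L(\varphi)=\min\{\mathrm{md}(\psi):\varphi\leftrightarrow\psi\in L\}$, $\mathrm{md}(L)=\sup_\varphi\mathrm{md}_L(\varphi)$. *)

(* Defs.v *)
From mathcomp Require Import all_boot all_order all_algebra.
From mathcomp Require Import boolp classical_sets cardinality constructive_ereal.

Set Implicit Arguments.
Unset Strict Implicit.
Unset Printing Implicit Defensive.

Import Order.TTheory GRing.Theory Num.Theory.

Local Open Scope classical_set_scope.

(* Only ever applied to nonempty sets; [xget] then never returns its default. *)
Definition least (S : set nat) : nat := xget 0%N (S `&` lbound S).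

Lemma leastP (S : set nat) : S !=set0 ->
  S (least S) /\ forall n, S n -> (least S <= n)%N.
Proof.
case=> n Sn; rewrite /least.
have exS : exists m, `[< S m >] by exists n; exact/asboolP.
case: (ex_minnP exS) => m /asboolP Sm mmin.
have Lm : (S `&` lbound S) m.
  by split=> // k Sk; rewrite leEnat; apply: mmin; exact/asboolP.
by have [Sl Ll] := xgetI 0%N Lm; split=> // k /Ll.
Qed.

(* Modal depths live in the extended natural numbers. They are embedded in
   [\bar int] because the library orders [\bar R] only over a [numDomainType].
   The supremum of no depths is the least depth, 0. *)
Definition depth (n : nat) : \bar int := (n%:Z)%:E%E.
Definition depth_sup (S : set (\bar int)) : \bar int := supremum 0%E S.

(* [supremum] would also be 0 on a nonempty set without least upper bound;
   there is no such set of depths. *)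
Lemma depth_supremums_neq0 (S : set (\bar int)) :
  S !=set0 -> (forall x, S x -> (0 <= x)%E) -> supremums S !=set0.
Proof.
case=> x0 Sx0 S0.
have ub0 y : ubound S y -> (0 <= y)%E.
  by move=> Sy; apply: le_trans (S0 _ Sx0) (Sy _ Sx0).
have [[m Sm]|unb] := pselect (exists m : nat, ubound S (depth m)); last first.
  exists +oo%E; split=> [x _|y Sy]; first exact: leey.
  case: y Sy (ub0 _ Sy) => [[j|j]| |] Sy //= _.
  by case: unb; exists j.
have exm : exists n, `[< ubound S (depth n) >] by exists m; exact/asboolP.
case: (ex_minnP exm) => k /asboolP Sk kmin; exists (depth k); split=> // y Sy.
case: y Sy (ub0 _ Sy) => [[j|j]| |] Sy //= _.
by rewrite lee_fin lez_nat; apply: kmin; exact/asboolP.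
Qed.

Section Frames.
Variable Al : Type.

Definition rel_preimage X (R : X -> X -> Prop) (V : set X) : set X :=
  [set x | exists2 y, V y & R x y].

(* The domain is allowed to be empty. *)
Record general_frame := GeneralFrame {
  domain :> Type;
  frel : Al -> domain -> domain -> Prop;
  adm : set (set domain);
  adm_set0 : adm set0;
  adm_setC : forall V, adm V -> adm (~` V);
  adm_setU : forall V W, adm V -> adm W -> adm (V `|` W);
  adm_preimage : forall a V, adm V -> adm (rel_preimage (frel a) V) }.

Section DisjointSum.
Variables (I : Type) (F : I -> general_frame).

Inductive sum_rel (a : Al) : {i : I & F i} -> {i : I & F i} -> Prop :=
  SumRel i (x y : F i) :
    frel a x y -> sum_rel a (existT _ i x) (existT _ i y).

Definition sum_adm : set (set {i : I & F i}) :=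
  [set V | forall i, @adm (F i) (existT _ i @^-1` V)].

Lemma sum_adm_set0 : sum_adm set0.
Proof. by move=> i; exact: adm_set0. Qed.

Lemma sum_adm_setC V : sum_adm V -> sum_adm (~` V).
Proof. by move=> aV i; exact: adm_setC (aV i). Qed.

Lemma sum_adm_setU V W : sum_adm V -> sum_adm W -> sum_adm (V `|` W).
Proof. by move=> aV aW i; exact: adm_setU (aV i) (aW i). Qed.

Lemma sum_relP a i (x : F i) q : sum_rel a (existT _ i x) q <->
  exists2 y : F i, q = existT _ i y & frel a x y.
Proof.
split=> [|[y -> xy]]; last exact: SumRel.
move ep : (existT _ i x) => p pq; case: pq ep => j x' y' xy ep.
have ej : i = j := congr1 (@projT1 _ _) ep.
case: _ / ej x' y' xy ep => x' y' xy ep.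
move: (projT2_eq ep); rewrite (Prop_irrelevance (projT1_eq ep) erefl) /= => ->.
by exists y'.
Qed.

Lemma sum_adm_preimage a V :
  sum_adm V -> sum_adm (rel_preimage (sum_rel a) V).
Proof.
move=> aV i; suff -> : existT _ i @^-1` rel_preimage (sum_rel a) V =
    rel_preimage (@frel (F i) a) (existT _ i @^-1` V) by exact: adm_preimage (aV i).
apply/seteqP; split=> x /=.
  by case=> q Vq /sum_relP[y eq xy]; exists y => //=; rewrite -eq.
by case=> y Vy xy; exists (existT _ i y) => //; exact: SumRel.
Qed.

Definition disjoint_sum : general_frame :=
  GeneralFrame sum_adm_set0 sum_adm_setC sum_adm_setU sum_adm_preimage.

End DisjointSum.

(* "Countable" includes "finite". The empty sum, whose domain is empty, is
   excluded, so that classes of frames with nonempty domains qualify. *)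
Definition closed_under_countable_sums (FF : set general_frame) : Prop :=
  forall (I : Type) (F : I -> general_frame),
    [set: I] !=set0 -> countable [set: I] ->
    (forall i, FF (F i)) -> FF (disjoint_sum F).

Definition induced_equiv X (VV : set (set X)) (a b : X) : Prop :=
  forall V, VV V -> (V a <-> V b).

Definition quotient X (E : X -> X -> Prop) : set (set X) :=
  [set [set b | E a b] | a in [set: X]].

Section FrameDepth.
Variable F : general_frame.

Fixpoint depth_partition (VV : set (set F)) (d : nat) : set (set F) :=
  match d with
  | 0 => quotient (induced_equiv VV)
  | d'.+1 =>
      let W := depth_partition VV d' in
      quotient (induced_equiv
        (W `|` [set U | exists a, exists2 V, W V & U = rel_preimage (frel a) V]))
  end.

Definition depth_union (VV : set (set F)) : set (set F) :=
  \bigcup_d depth_partition VV d.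

Definition md_set (VV : set (set F)) (V : set F) : nat :=
  least [set d | depth_partition VV d V].

Definition md_family (VV : set (set F)) : \bar int :=
  depth_sup [set depth (md_set VV V) | V in depth_union VV].

Definition md_frame : \bar int :=
  depth_sup [set md_family VV | VV in [set VV | finite_set VV /\ VV `<=` @adm F]].

End FrameDepth.

Definition md_class (FF : set general_frame) : \bar int :=
  depth_sup [set md_frame F | F in FF].

(* Countably infinitely many propositional variables. *)
Inductive formula : Type :=
| Var of nat
| Bot
| Imp of formula & formula
| Dia of Al & formula.

Definition Neg (p : formula) : formula := Imp p Bot.
Definition Conj (p q : formula) : formula := Neg (Imp p (Neg q)).
Definition Iff (p q : formula) : formula := Conj (Imp p q) (Imp q p).

Fixpoint md_nesting (p : formula) : nat :=
  match p with
  | Var _ => 0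
  | Bot => 0
  | Imp q r => maxn (md_nesting q) (md_nesting r)
  | Dia _ q => (md_nesting q).+1
  end.

Fixpoint truth_set (F : general_frame) (v : nat -> set F) (p : formula) : set F :=
  match p with
  | Var n => v n
  | Bot => set0
  | Imp q r => [set x | truth_set v q x -> truth_set v r x]
  | Dia a q => rel_preimage (frel a) (truth_set v q)
  end.

Definition valid (F : general_frame) (p : formula) : Prop :=
  forall v : nat -> set F, (forall n, adm (v n)) -> forall x, truth_set v p x.

Definition Log (FF : set general_frame) : set formula :=
  [set p | forall F, FF F -> valid F p].

Definition md_formula (L : set formula) (p : formula) : nat :=
  least [set md_nesting q | q in [set q | L (Iff p q)]].

Definition md_logic (L : set formula) : \bar int :=
  depth_sup [set depth (md_formula L p) | p in [set: formula]].

End Frames.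

(* Main.v *)
(** A family of finitely many admissible sets is the range of a valuation of
    finitely many variables. Under it the blocks of the [d]-th partition are
    finite in number and definable by formulas of nesting at most [d], while any
    such formula is constant on these blocks.

    If every formula is equivalent in the logic to one of nesting at most [m],
    then a block of any partition is defined by such a formula, and being
    invariant at level [m] it already is a block of level at most [m].

    Conversely, let the frames have depth at most [m], and suppose that no [q] of
    nesting at most [m] is equivalent to [p]. The disjoint sum of countermodels
    to [p <-> q], one for each [q], is in the class. The truth set of [p] in it
    is a finite union of blocks of level at most [m], hence is defined by a
    single [q] of nesting at most [m], contradicting the countermodel for [q]. *)

Require Import Defs.
From mathcomp Require Import all_boot all_order all_algebra.
From mathcomp Require Import boolp classical_sets cardinality constructive_ereal.

Set Implicit Arguments.
Unset Strict Implicit.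
Unset Printing Implicit Defensive.

Import Order.TTheory GRing.Theory Num.Theory.
(* Re-imported so that [frel] is not the one of [eqtype]. *)
Import Defs.

Local Open Scope classical_set_scope.

(** * Minima and suprema of depths *)

Lemma least_le (S : set nat) (m : nat) : S !=set0 ->
  (least S <= m)%N <-> exists2 n, S n & (n <= m)%N.
Proof.
move=> /leastP[Sl lmin]; split; first by exists (least S).
by case=> n /lmin; exact: leq_trans.
Qed.

Lemma depth_ge0 n : (0 <= depth n)%E.
Proof. by rewrite lee_fin. Qed.

Lemma depth_le n m : (depth n <= depth m)%E = (n <= m)%N.
Proof. by rewrite lee_fin lez_nat. Qed.

Lemma depth_sup_supremums (S : set (\bar int)) :
  S !=set0 -> (forall x, S x -> (0 <= x)%E) -> supremums S (depth_sup S).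
Proof.
move=> S0 Sge0; rewrite /depth_sup /supremum.
case: eqP => [SE|_]; first by case: S0 => x; rewrite SE.
exact: xgetPex (depth_supremums_neq0 S0 Sge0).
Qed.

Lemma depth_sup_ge0 (S : set (\bar int)) :
  (forall x, S x -> (0 <= x)%E) -> (0 <= depth_sup S)%E.
Proof.
move=> Sge0; have [->|/set0P S0] := eqVneq S set0.
  by rewrite /depth_sup /supremum eqxx.
have [ubS _] := depth_sup_supremums S0 Sge0.
by case: S0 => x Sx; apply: le_trans (Sge0 _ Sx) (ubS _ Sx).
Qed.

(** The empty set is no exception: its supremum is 0, which lies below every depth. *)
Lemma depth_sup_le (S : set (\bar int)) m : (forall x, S x -> (0 <= x)%E) ->
  (depth_sup S <= depth m)%E <-> forall x, S x -> (x <= depth m)%E.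
Proof.
move=> Sge0; have [->|/set0P S0] := eqVneq S set0.
  by rewrite /depth_sup /supremum eqxx; split=> // _; exact: depth_ge0.
have [ubS lubS] := depth_sup_supremums S0 Sge0.
split=> [Sm x Sx|Sm]; first exact: le_trans (ubS _ Sx) Sm.
exact: lubS.
Qed.

(** A nonnegative element of [\bar int] is a natural number or [+oo], so its natural upper bounds
    determine it. *)
Lemma eq_depth_bounds (x y : \bar int) : (0 <= x)%E -> (0 <= y)%E ->
  (forall m, (x <= depth m)%E <-> (y <= depth m)%E) -> x = y.
Proof.
have le_of z t : (0 <= t)%E ->
    (forall m, (t <= depth m)%E -> (z <= depth m)%E) -> (z <= t)%E.
  case: t => [[n|n]| |] //= _ zt; last exact: leey.
  exact: (zt n).
move=> x0 y0 xy; apply/eqP; rewrite eq_le.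
by apply/andP; split; apply: le_of => // m /xy.
Qed.

(** * Partitions induced by finite families *)

Lemma induced_equiv_sym X (W : set (set X)) a b :
  induced_equiv W a b -> induced_equiv W b a.
Proof. by move=> ab V WV; split=> /(ab V WV). Qed.

(** Drives the inductions over a finite family: adding [V] splits each class into its parts inside
    and outside [V]. *)
Lemma quotient_induced_cons X (V : set X) (s : seq (set X)) a :
  [set b | induced_equiv [set` V :: s] a b] =
  (if `[< V a >] then V else ~` V) `&` [set b | induced_equiv [set` s] a b].
Proof.
apply/seteqP; split=> b /=.
  move=> ab; split; last by move=> W sW; apply: ab; rewrite /= inE sW orbT.
  have VV : V \in V :: s by rewrite mem_head.
  by case: asboolP => Va; [exact/(ab V VV)|move=> /(ab V VV)].
case=> Vb ab W /=; rewrite inE => /orP[/eqP ->|]; last exact: ab.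
by case: asboolP Vb.
Qed.

Lemma finite_quotient X (W : set (set X)) :
  finite_set W -> finite_set (quotient (induced_equiv W)).
Proof.
move=> /finite_seqP[s ->]; elim: s => [|V s IHs].
  apply: (sub_finite_set _ (finite_set1 setT)) => _ [a _ <-].
  by apply/seteqP; split.
have fV : finite_set [set V; ~` V] by rewrite finite_setU; split; exact: finite_set1.
apply: (sub_finite_set _ (finite_image2 setI fV IHs)) => _ [a _ <-].
rewrite quotient_induced_cons; eexists; last eexists; last reflexivity.
  by case: asboolP; [left|right].
by exists a.
Qed.

(** * Iterated partitions of a frame *)

Section Frame.
Variables (Al : Type) (F : general_frame Al).

(** The generators of the [d]-th partition, which make its base and successor cases uniform. *)
Definition depth_family (VV : set (set F)) (d : nat) : set (set F) :=
  if d is d'.+1 then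
    depth_partition VV d' `|`
      [set U | exists a, exists2 V, depth_partition VV d' V & U = rel_preimage (frel a) V]
  else VV.

Definition depth_equiv VV d : F -> F -> Prop := induced_equiv (depth_family VV d).

Lemma depth_partitionE VV d :
  depth_partition VV d = quotient (depth_equiv VV d).
Proof. by case: d. Qed.

Lemma depth_partition_class VV d a :
  depth_partition VV d [set b | depth_equiv VV d a b].
Proof. by rewrite depth_partitionE; exists a. Qed.

(** The block of [a] at each level is a generator of the next level, so the partitions get finer. *)
Lemma depth_equiv_anti VV d e a b :
  (d <= e)%N -> depth_equiv VV e a b -> depth_equiv VV d a b.
Proof.
move=> de; rewrite -(subnK de); elim: (e - d)%N => [|i IHi] //=.
rewrite addSn => ab; apply: IHi.
by have [+ _] := ab _ (or_introl (depth_partition_class VV (i + d) a)); apply.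
Qed.

(** The zigzag condition of bounded bisimulation: the preimage of the block of [x] is a generator at
    level [d.+1]. *)
Lemma depth_equiv_preimage VV d c a b x : depth_equiv VV d.+1 a b ->
  frel c a x -> exists2 y, frel c b y & depth_equiv VV d x y.
Proof.
move=> ab ax; set V := [set y | depth_equiv VV d x y].
have genV : depth_family VV d.+1 (rel_preimage (frel c) V).
  by right; exists c, V => //; exact: depth_partition_class.
have [+ _] := ab _ genV; by case=> [|y xy by_]; [exists x|exists y].
Qed.

Lemma md_set_le (VV : set (set F)) V m : depth_union VV V ->
  (md_set VV V <= m)%N <-> exists2 e, (e <= m)%N & depth_partition VV e V.
Proof.
case=> d _ Vd; rewrite /md_set least_le; last by exists d.
by split=> -[e ? ?]; exists e.
Qed.

Lemma md_family_ge0 (VV : set (set F)) : (0 <= md_family VV)%E.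
Proof. by apply: depth_sup_ge0 => _ [V _ <-]; exact: depth_ge0. Qed.

Lemma md_frame_ge0 : (0 <= md_frame F)%E.
Proof. by apply: depth_sup_ge0 => _ [VV _ <-]; exact: md_family_ge0. Qed.

Lemma md_frame_le m : (md_frame F <= depth m)%E <->
  forall VV : set (set F), finite_set VV -> VV `<=` @adm _ F -> forall d V,
    depth_partition VV d V -> exists2 e, (e <= m)%N & depth_partition VV e V.
Proof.
rewrite /md_frame depth_sup_le; last by move=> _ [VV _ <-]; exact: md_family_ge0.
have famP (VV : set (set F)) : (md_family VV <= depth m)%E <-> forall d V,
    depth_partition VV d V -> exists2 e, (e <= m)%N & depth_partition VV e V.
  rewrite /md_family depth_sup_le; last by move=> _ [V _ <-]; exact: depth_ge0.
  split=> [H d V Vd|H _ [V UV <-]].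
    have UV : depth_union VV V by exists d.
    by apply/md_set_le => //; rewrite -depth_le; apply: H; exists V.
  by rewrite depth_le; apply/md_set_le => //; case: UV => d _ /H.
split=> [H VV finV admV|H _ [VV [finV admV] <-]].
  by apply/famP/H; exists VV.
by apply/famP/H.
Qed.

End Frame.

Lemma md_class_ge0 (Al : Type) (FF : set (general_frame Al)) :
  (0 <= md_class FF)%E.
Proof. by apply: depth_sup_ge0 => _ [F _ <-]; exact: md_frame_ge0. Qed.

Lemma md_class_le (Al : Type) (FF : set (general_frame Al)) m :
  (md_class FF <= depth m)%E <-> forall F, FF F -> (md_frame F <= depth m)%E.
Proof.
rewrite /md_class depth_sup_le; last by move=> _ [F _ <-]; exact: md_frame_ge0.
by split=> [H F FFF|H _ [F FFF <-]]; apply: H => //; exists F.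
Qed.

(** * Truth, disjoint sums and the variables of a formula *)

Section Formulas.
Variable Al : Type.
Implicit Types (F : general_frame Al) (p q : formula Al).

Lemma truth_Conj F (v : nat -> set F) p q :
  truth_set v (Conj p q) = truth_set v p `&` truth_set v q.
Proof.
apply/seteqP; split=> x /=; last by move=> [px qx] npq; exact: npq.
by move=> npq; split; apply: contrapT => nx; apply: npq.
Qed.

Lemma truth_Iff F (v : nat -> set F) p q x :
  truth_set v (Iff p q) x <-> (truth_set v p x <-> truth_set v q x).
Proof. by rewrite truth_Conj; split=> -[]. Qed.

Lemma md_logic_ge0 (L : set (formula Al)) : (0 <= md_logic L)%E.
Proof. by apply: depth_sup_ge0 => _ [p _ <-]; exact: depth_ge0. Qed.

Lemma md_logic_le (FF : set (general_frame Al)) m :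
  (md_logic (Log FF) <= depth m)%E <->
  forall p, exists2 q, (md_nesting q <= m)%N & Log FF (Iff p q).
Proof.
rewrite /md_logic depth_sup_le; last by move=> _ [p _ <-]; exact: depth_ge0.
have mdP p : (depth (md_formula (Log FF) p) <= depth m)%E <->
    exists2 q, (md_nesting q <= m)%N & Log FF (Iff p q).
  rewrite depth_le least_le; last first.
    by exists (md_nesting p), p => // F FFF v admv x; exact/truth_Iff.
  split=> [[_ [q Lq <-] qm]|[q qm Lq]]; first by exists q.
  by exists (md_nesting q) => //; exists q.
split=> [H p|H _ [p _ <-]]; last exact/mdP.
by apply/mdP/H; exists p.
Qed.

(** Successors of a point stay in its summand, so truth is local to the summand. *)
Lemma truth_sum (I : Type) (F : I -> general_frame Al)
    (v : forall i, nat -> set (F i)) p i (x : F i) :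
  @truth_set _ (disjoint_sum F)
    (fun n => [set s | v (projT1 s) n (projT2 s)]) p (existT _ i x) <->
  truth_set (v i) p x.
Proof.
elim: p i x => [n|//|q IHq r IHr|a q IHq] i x /=.
- by [].
- by rewrite IHq IHr.
split=> [[s qs /sum_relP[y sE xy]]|[y qy xy]].
  by rewrite sE in qs; exists y => //; exact/IHq.
by exists (existT _ i y); [exact/IHq|exact: SumRel].
Qed.

Fixpoint vars_below (k : nat) (p : formula Al) : bool :=
  match p with
  | Var n => (n < k)%N
  | Bot => true
  | Imp q r => vars_below k q && vars_below k r
  | Dia _ q => vars_below k q
  end.

Lemma vars_below_leq k l p : (k <= l)%N -> vars_below k p -> vars_below l p.
Proof.
move=> kl; elim: p => [n|//|q IHq r IHr|//] /=; first by move/leq_trans; apply.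
by move=> /andP[/IHq -> /IHr ->].
Qed.

Lemma ex_vars_below p : exists k, vars_below k p.
Proof.
elim: p => [n||q [k kq] r [l lr]|a q [k kq]]; first by exists n.+1 => /=.
- by exists 0%N.
- exists (maxn k l) => /=.
  by rewrite (vars_below_leq (leq_maxl _ _) kq) (vars_below_leq (leq_maxr _ _) lr).
- by exists k.
Qed.

(** A reduced formula may bring in new variables; where these are valued by [set0], [Bot] can
    replace them. *)
Fixpoint erase_vars (k : nat) (p : formula Al) : formula Al :=
  match p with
  | Var n => if (n < k)%N then Var Al n else Bot Al
  | Bot => Bot Al
  | Imp q r => Imp (erase_vars k q) (erase_vars k r)
  | Dia a q => Dia a (erase_vars k q)
  end.

Lemma erase_vars_below k p : vars_below k (erase_vars k p).
Proof. by elim: p => [n||q IHq r IHr|] //=; [case: ltnP|rewrite IHq]. Qed.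

Lemma md_nesting_erase_vars k p : md_nesting (erase_vars k p) = md_nesting p.
Proof.
by elim: p => [n||q IHq r IHr|a q IHq] //=; [case: ltnP|rewrite IHq IHr|rewrite IHq].
Qed.

Lemma truth_erase_vars F (v : nat -> set F) k p :
  (forall n, (k <= n)%N -> v n = set0) ->
  truth_set v (erase_vars k p) = truth_set v p.
Proof.
move=> v0; elim: p => [n||q IHq r IHr|a q IHq] //=.
- by case: ltnP => // /v0.
- by rewrite IHq IHr.
- by rewrite IHq.
Qed.

End Formulas.

(** * Blocks and definable sets *)

Section Definability.
Variables (Al : finType) (F : general_frame Al) (v : nat -> set F) (k : nat).

Let VV : set (set F) := [set v n | n in `I_k].

Definition definable (d : nat) : set (set F) :=
  [set truth_set v q | q in [set q | vars_below k q /\ (md_nesting q <= d)%N]].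

Lemma definable_leq d e : (d <= e)%N -> definable d `<=` definable e.
Proof.
by move=> de _ [q [qk qd] <-]; exists q => //; split=> //; exact: leq_trans de.
Qed.

Lemma definable0 d : definable d set0.
Proof. by exists (Bot Al). Qed.

Lemma definableC d V : definable d V -> definable d (~` V).
Proof.
move=> [q [qk qd] <-]; exists (Neg q) => //.
by split=> /=; rewrite ?qk ?maxn0.
Qed.

Lemma definableI d V W : definable d V -> definable d W -> definable d (V `&` W).
Proof.
move=> [q [qk qd] <-] [r [rk rd] <-]; exists (Conj q r); last by rewrite truth_Conj.
by split=> /=; rewrite ?qk ?rk // !maxn0 geq_max qd.
Qed.

Lemma definableU d V W : definable d V -> definable d W -> definable d (V `|` W).
Proof.
move=> dV dW; rewrite -(setCK (V `|` W)) setCU.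
by apply/definableC/definableI; exact: definableC.
Qed.

Lemma definable_preimage d c V :
  definable d V -> definable d.+1 (rel_preimage (frel c) V).
Proof. by move=> [q [qk qd] <-]; exists (Dia c q). Qed.

Lemma definable_quotient d (W : set (set F)) : finite_set W ->
  W `<=` definable d -> quotient (induced_equiv W) `<=` definable d.
Proof.
move=> /finite_seqP[s ->] + _ [a _ <-]; elim: s => [_|V s IHs sd].
  rewrite (_ : mkset _ = ~` set0); last by rewrite setC0; apply/seteqP; split.
  exact/definableC/definable0.
rewrite quotient_induced_cons; apply: definableI.
  have dV : definable d V by apply: sd; rewrite /= mem_head.
  by case: asboolP => _ //; exact: definableC.
by apply: IHs => U sU; apply: sd; rewrite /= inE sU orbT.
Qed.

(** The two claims go up the levels together: a block is a Boolean combination of generators, and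
    finiteness makes it expressible by one formula. *)
Lemma finite_definable_family d :
  finite_set (depth_family VV d) /\ depth_family VV d `<=` definable d.
Proof.
elim: d => [|d [finW Wd]] /=.
  split; first exact/finite_image/finite_II.
  by move=> _ [n nk <-]; exists (Var _ n).
have finQ := finite_quotient finW; have Qd := definable_quotient finW Wd.
rewrite depth_partitionE; split.
  rewrite finite_setU; split=> //.
  have finAl : finite_set [set: Al] by exact: finite_finset.
  apply: (sub_finite_set _ (finite_image2 (fun c V => rel_preimage (frel c) V) finAl finQ)).
  by move=> _ [c [V QV ->]]; exists c => //; exists V.
move=> U [/Qd|[c [V /Qd dV ->]]]; first exact: definable_leq.
exact: definable_preimage.
Qed.

Lemma finite_depth_partition d : finite_set (depth_partition VV d).
Proof.
by rewrite depth_partitionE; apply: finite_quotient; case: (finite_definable_family d).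
Qed.

Lemma depth_partition_definable d : depth_partition VV d `<=` definable d.
Proof.
rewrite depth_partitionE; have [finW Wd] := finite_definable_family d.
exact: definable_quotient.
Qed.

(** The level [d] varies in the induction, since a diamond uses up one level through
    [depth_equiv_preimage]. *)
Lemma definable_invariant d V a b :
  definable d V -> depth_equiv VV d a b -> (V a <-> V b).
Proof.
move=> [p [pk pd] <-]; elim: p d pk pd a b => [n|//|q IHq r IHr|c q IHq] d /=.
- move=> nk _ a b ab; have ab0 := depth_equiv_anti (leq0n d) ab.
  by apply: ab0; exists n.
- move=> /andP[qk rk]; rewrite geq_max => /andP[qd rd] a b ab.
  by rewrite (IHq d qk qd a b ab) (IHr d rk rd a b ab).
case: d => // d qk qd.
have half a b : depth_equiv VV d.+1 a b ->
    rel_preimage (frel c) (truth_set v q) a ->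
    rel_preimage (frel c) (truth_set v q) b.
  move=> ab [x qx ax]; have [y by_ xy] := depth_equiv_preimage ab ax.
  by exists y => //; apply/(IHq d qk qd x y xy).
by move=> a b ab; split; apply: half => //; exact: induced_equiv_sym.
Qed.

Lemma definable_bigcup d (S : set (set F)) : finite_set S ->
  S `<=` definable d -> definable d (\bigcup_(V in S) V).
Proof.
move=> /finite_seqP[s ->] sd; rewrite bigcup_seq big_seq.
by apply: big_ind => [|V W|V sV]; [exact: definable0|exact: definableU|exact: sd].
Qed.

(* A formula of any nesting defines a union of blocks, and there are only
   finitely many of them. *)
Lemma definable_of_blocks m d V :
  (forall U, depth_partition VV d U ->
    exists2 e, (e <= m)%N & depth_partition VV e U) ->
  definable d V -> definable m V.
Proof.
move=> blocks dV.
pose S := [set U | depth_partition VV d U /\ U `<=` V].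
have -> : V = \bigcup_(U in S) U.
  apply/seteqP; split=> [a Va|a [U [_ UV] /UV]//].
  exists [set b | depth_equiv VV d a b] => //; split; first exact: depth_partition_class.
  by move=> b /= ab; apply/(definable_invariant dV ab).
apply: definable_bigcup; first by apply: sub_finite_set (finite_depth_partition d) => U [].
by move=> U [/blocks[e em /depth_partition_definable dU] _]; exact: definable_leq dU.
Qed.

(** If [m < d], the block of [a] at level [d] lies in its block at level [m]; invariance of [V] at
    level [m] gives the converse inclusion. *)
Lemma definable_block m d V : depth_partition VV d V -> definable m V ->
  exists2 e, (e <= m)%N & depth_partition VV e V.
Proof.
move=> Vd Vm; have [dm|/ltnW md] := leqP d m; first by exists d.
exists m => //; move: Vd Vm; rewrite depth_partitionE => -[a _ <-] Vm.
rewrite (_ : mkset _ = [set b | depth_equiv VV m a b]); first exact: depth_partition_class.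
apply/seteqP; split=> b /=; first exact: depth_equiv_anti.
by move=> ab; have [+ _] := definable_invariant Vm ab; apply.
Qed.

End Definability.

(** * Enumeration of formulas *)

Section Countability.
Variable Al : countType.

Fixpoint formula_tree (p : formula Al) : GenTree.tree (nat + Al) :=
  match p with
  | Var n => GenTree.Leaf (inl n)
  | Bot => GenTree.Node 0 [::]
  | Imp q r => GenTree.Node 1 [:: formula_tree q; formula_tree r]
  | Dia a q => GenTree.Node 2 [:: GenTree.Leaf (inr a); formula_tree q]
  end.

Lemma formula_tree_inj : injective formula_tree.
Proof.
elim=> [n||q IHq r IHr|a q IHq] [n'||q' r'|a' q'] //=.
- by case=> ->.
- by case=> /IHq -> /IHr ->.
- by case=> -> /IHq ->.
Qed.

(** Numbers that code no formula satisfying [P] are sent to [p0]. *)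
Lemma enum_formulas (P : pred (formula Al)) p0 : P p0 ->
  exists e : nat -> formula Al, (forall n, P (e n)) /\ forall p, P p -> exists n, e n = p.
Proof.
move=> Pp0.
have /choice[e eP] : forall n, exists q, P q /\
    forall p, P p -> pickle (formula_tree p) = n -> q = p.
  move=> n; have [[q [Pq qn]]|noq] :=
    pselect (exists q, P q /\ pickle (formula_tree q) = n).
    exists q; split=> // p Pp pn; apply/formula_tree_inj/(pcan_inj pickleK).
    by rewrite qn pn.
  by exists p0; split=> // p Pp pn; case: noq; exists p.
exists e; split=> [n|p Pp]; first by case: (eP n).
by exists (pickle (formula_tree p)); have [_] := eP (pickle (formula_tree p)); apply.
Qed.

End Countability.

(** * Comparison of the two depths *)

Theorem theorem6p13 (Al : finType) (FF : set (general_frame Al)) :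
  closed_under_countable_sums FF -> md_class FF = md_logic (Log FF).
Proof.
move=> sumFF; apply: eq_depth_bounds => [||m].
- exact: md_class_ge0.
- exact: md_logic_ge0.
rewrite md_class_le md_logic_le; split=> [depthFF p|reduce F FFF]; last first.
  apply/md_frame_le => VV /finite_seqP[s VVE] admVV d V.
  (* The default [set0] is admissible and is what [erase_vars] needs beyond the end of [s]. *)
  pose v n := nth set0 s n.
  have admv n : @adm _ F (v n).
    have [ns|ns] := ltnP n (size s); last by rewrite /v nth_default //; exact: adm_set0.
    by apply: admVV; rewrite VVE /= mem_nth.
  have {VVE}-> : VV = [set v n | n in `I_(size s)].
    rewrite VVE; apply/seteqP; split=> [U /= /(nthP set0)[n ns <-]|_ [n ns <-]].
      by exists n.
    by rewrite /= mem_nth.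
  move=> Vd; have [p [pk pd] pV] := depth_partition_definable Vd.
  have [q qm Lpq] := reduce p.
  apply: definable_block (Vd) _; exists (erase_vars (size s) q).
    by rewrite /= erase_vars_below md_nesting_erase_vars.
  rewrite truth_erase_vars => [|n ns]; last exact: nth_default.
  rewrite -pV; apply/seteqP; split=> x /=; have /truth_Iff pq := Lpq F FFF v admv x;
    by move/pq.
apply: contrapT => nored.
have [k pk] := ex_vars_below p.
(* The sum is indexed by [nat] rather than by formulas, whose universe is too
   large to index a sum of frames. *)
have [e [em e_surj]] :=
  enum_formulas (P := fun q => (md_nesting q <= m)%N) (p0 := Bot Al) (leq0n m).
have /choice[u uP] : forall i, exists w : {F : general_frame Al & nat -> set F},
    [/\ FF (projT1 w), forall n, adm (projT2 w n) &
      exists x, ~ truth_set (projT2 w) (Iff p (e i)) x].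
  (* Without a countermodel, [e i] would be a reduction of [p] to nesting at most [m]. *)
  move=> i; apply: contrapT => noF; apply: nored.
  exists (e i) => [|F FFF v admv x]; first exact: em.
  by apply: contrapT => nx; apply: noF; exists (existT _ F v); split=> //; exists x.
pose G := disjoint_sum (fun i => projT1 (u i)).
have FFG : FF G.
  apply: sumFF => [||i]; last by case: (uP i).
    by exists 0%N.
  exact: countableP.
(* The valuations of the countermodels are glued into one on the sum. *)
pose v n : set G := [set s | projT2 (u (projT1 s)) n (projT2 s)].
have admv n : adm (v n) by move=> i; have [_ + _] := uP i; apply.
have /md_frame_le blocks := depthFF G FFG.
have [||q [_ qm] qp] := definable_of_blocks (m := m) (v := v) (k := k)
  (d := md_nesting p) (V := truth_set v p).
- apply: blocks; first exact/finite_image/finite_II.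
  by move=> _ [n _ <-].
- by exists p.
(* The formula [q] occurs as some [e i], so it must fail to agree with [p] somewhere in the [i]-th
   summand. *)
have [i ei] := e_surj q qm; have [_ _ [x]] := uP i; apply.
apply/truth_Iff; rewrite ei -!(truth_sum (fun i => projT2 (u i))).
by rewrite -/G -/v qp.
Qed.
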